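(* Let $N,M\in\mathbb{N}$ and suppose that $\cos(\theta^{2,\alpha}_{N,M})>0$. Then the reconstruction $f^{\alpha}_{N,M}$ exists uniquely and satisfies the sharp bounds $$\|f^{\alpha}_{N,M}\|_{\mathsf{X}}\le \sec(\theta^{2,\alpha}_{N,M})\,\|f^{\alpha}\|_{\mathsf{X}},$$ and $$\|f^{\alpha}-f^{\alpha}_{N,M}\|_{\mathsf{X}}\le \sec(\theta^{2,\alpha}_{N,M})\,\|f^{\alpha}-\mathcal{P}_{\mathsf{T}_M}f^{\alpha}\|_{\mathsf{X}}.$$ Furthermore, $$\|f^{\dagger}-f^{\alpha}_{N,M}\|_{\mathsf{X}}\le\bigl(1+2\sec(\theta^{2,\alpha}_{N,M})\bigr)\|f^{\dagger}-f^{\alpha}\|_{\mathsf{X}}+\sec(\theta^{2,\alpha}_{N,M})\,\|f^{\dagger}-\mathcal{P}_{\mathsf{T}_M}f^{\dagger}\|_{\mathsf{X}}.$$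
   Context: Let $\mathsf{X},\mathsf{Y}$ be separable complex Hilbert spaces and $\mathcal{A}:\mathsf{X}\to\mathsf{Y}$ a compact bounded linear operator with singular system $\{\sigma_k,v_k,u_k\}_{k\in\mathbb{N}}$: $\sigma_1\ge\sigma_2\ge\dots>0$, $\{v_k\}$ is an orthonormal basis of $\mathsf{V}:=N(\mathcal{A})^{\perp}$, $\{u_k\}$ is an orthonormal basis of $\mathsf{U}:=N(\mathcal{A}^* )^{\perp}$, $\mathcal{A}v_k=\sigma_ku_k$, $\mathcal{A}^*u_k=\sigma_kv_k$ ($N(\cdot)$ denotes the null space). Let $\{\varphi_k\}_{k\in\mathbb{N}}$ be a frame for $\mathsf{T}:=N(\mathcal{A})^{\perp}=\mathsf{V}$ and $\mathsf{T}_M:=\mathrm{span}\{\varphi_1,\dots,\varphi_M\}$. $\mathcal{P}_{\mathsf{W}}$ denotes the orthogonal projection onto a closed subspace $\mathsf{W}$. Let $f\in\mathsf{X}$, $g=\mathcal{A}f$ and $f^{\dagger}:=\mathcal{A}^{\dagger}g$, where $\mathcal{A}^{\dagger}$ is the (Moore–Penrose) generalized inverse. Filter: $\mathcal{F}_{\alpha}$ is a positive function on $\{\sigma_k^2:k\in\mathbb{N}\}$ with $0<\inf_k\mathcal{F}_\alpha(\sigma_k^2)\le\sup_k\mathcal{F}_\alpha(\sigma_k^2)<\infty$. Set $\mathcal{R}_\alpha h:=\mathcal{F}_\alpha(\mathcal{A}^*\mathcal{A})\mathcal{A}^*h=\sum_{k}\mathcal{F}_\alpha(\sigma_k^2)\sigma_k\langle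 h,u_k\rangle v_k$ and $f^{\alpha}:=\mathcal{R}_\alpha g$. Let $T_M:\mathbb{C}^M\to\mathsf{X}$, $T_M\beta=\sum_{j=1}^M\beta_j\varphi_j$; $V_N:\mathbb{C}^N\to\mathsf{X}$, $V_N\beta=\sum_{k=1}^N\beta_kv_k$; $U_N:\mathbb{C}^N\to\mathsf{Y}$, $U_N\beta=\sum_{k=1}^N\beta_ku_k$; $\Theta_{\alpha,N}=\mathrm{diag}(\mathcal{F}_\alpha(\sigma_1^2),\dots,\mathcal{F}_\alpha(\sigma_N^2))$; $\Sigma_N=\mathrm{diag}(\sigma_1,\dots,\sigma_N)$. The reconstruction is $f^{\alpha}_{N,M}:=T_M\beta^{\alpha}_{N,M}$, where $\beta^{\alpha}_{N,M}\in\mathbb{C}^M$ solves $$T_M^*V_N\Theta_{\alpha,N}^{-2}V_N^*T_M\,\beta^{\alpha}_{N,M}=T_M^*V_N\Theta_{\alpha,N}^{-1}\Sigma_NU_N^*g .$$ For closed subspaces $\mathsf{W}_1,\mathsf{W}_2$ of a Hilbert space the subspace angle $\theta_{\mathsf{W}_1,\mathsf{W}_2}\in[0,\pi/2]$ is defined by $\cos\theta_{\mathsf{W}_1,\mathsf{W}_2}=\inf_{w\in\mathsf{W}_1,\|w\|=1}\|\mathcal{P}_{\mathsf{W}_2}w\|$. Define $\mathcal{L}^{\alpha}_N h=\sum_{k=1}^N\mathcal{F}_\alpha(\sigma_k^2)^{-2}\langle h,v_k\rangle v_k$ on $\mathsf{X}$ and $\theta^{2,\alpha}_{N,M}:=\theta_{\mathsf{T}_M,\,\mathcal{L}^{\alpha}_N(\mathsf{T}_M)}$.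 ''Sharp'' means that the constant $\sec(\theta^{2,\alpha}_{N,M})$ cannot be replaced by a smaller constant valid for all data $g$. *)

(* Defs.v *)
From HB Require Import structures.
From mathcomp Require Import all_boot all_order all_algebra.
From mathcomp Require Import complex.
From mathcomp Require Import all_classical all_reals all_analysis.

Set Implicit Arguments.
Unset Strict Implicit.
Unset Printing Implicit Defensive.

Import Order.TTheory GRing.Theory Num.Theory Num.Def.
Import numFieldNormedType.Exports.

Local Open Scope classical_set_scope.
Local Open Scope complex_scope.
Local Open Scope ring_scope.

(* The norm of a normed space over R[i] takes (real) values in R[i]; [nrm] is
   the same norm with values in R. *)
Definition nrm (R : realType) (V : normedZmodType R[i]) (x : V) : R :=
  complex.Re `|x|.

Definition separable_space (T : topologicalType) : Prop :=
  exists D : set T, countable D /\ dense D.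

Section Hilbert.
Variables (R : realType) (X : completeNormedModType R[i]).

(* Inner products [dX : {dot X for conjC}] are linear in the first argument and
   conjugate-linear in the second.  A complex Hilbert space is a complete
   normed space whose norm is induced by such a form. *)
Definition induces_norm (dX : {dot X for conjC}) : Prop :=
  forall x : X, dX x x = `|x| ^+ 2.

Variable dX : {dot X for conjC}.

Definition ortho_compl (W : set X) : set X :=
  [set x | forall w, W w -> dX x w = 0].

(* The element p is unique when it exists; it does for closed subspaces W. *)
Definition ortho_proj (W : set X) (x : X) : X :=
  xget 0 [set p | W p /\ ortho_compl W (x - p)].

(* When W1 contains no unit vector the infimum is that of the empty set, which
   the library sets to 0; the angle is then pi / 2. *)
Definition subspace_angle (W1 W2 : set X) : R :=
  acos (inf [set nrm (ortho_proj W2 w) | w in [set w | W1 w /\ nrm w = 1]]).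

Definition synthesis (e : nat -> X) (n : nat) (b : 'cV[R[i]]_n) : X :=
  \sum_(j < n) b j ord0 *: e j.

Definition analysis (e : nat -> X) (n : nat) (x : X) : 'cV[R[i]]_n :=
  \col_(j < n) dX x (e j).

(* [analysis e n] is the adjoint of [@synthesis e n] for the standard inner
   product of C^n. *)
Lemma synthesis_analysis_adjoint (e : nat -> X) (n : nat) (b : 'cV[R[i]]_n)
    (x : X) :
  dX (synthesis e b) x = \sum_(j < n) b j ord0 * conjC (analysis e n x j ord0).
Proof.
have dC y : dX y x = conjC (dX x y).
  by have := hermC dX y x; rewrite expr0 mul1r.
rewrite /synthesis linear_sumlz; apply: eq_bigr => j _.
by rewrite linearZl_LR mxE -dC.
Qed.

Definition first_span (e : nat -> X) (n : nat) : set X :=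
  range (@synthesis e n).

Definition orthonormal_basis (W : set X) (e : nat -> X) : Prop :=
  (forall i j, dX (e i) (e j) = (i == j)%:R) /\
  closure (\bigcup_n first_span e n) = W.

Definition frame (W : set X) (phi : nat -> X) : Prop :=
  (forall k, W (phi k)) /\
  exists a b : R, [/\ 0 < a, 0 < b &
    forall x, W x ->
      ((a * nrm x ^+ 2)%:E <= \sum_(0 <= k <oo) (nrm (dX x (phi k)) ^+ 2)%:E)%E
      /\
      (\sum_(0 <= k <oo) (nrm (dX x (phi k)) ^+ 2)%:E <= (b * nrm x ^+ 2)%:E)%E].

End Hilbert.

Section Operators.
Variables (R : realType) (X Y : completeNormedModType R[i]).
Variables (dX : {dot X for conjC}) (dY : {dot Y for conjC}).

Definition null_space (B : X -> Y) : set X := B @^-1` [set 0].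

Definition compact_operator (B : X -> Y) : Prop :=
  forall S : set X, bounded_set S -> compact (closure (B @` S)).

Definition adjoint (B : X -> Y) (y : Y) : X :=
  xget 0 [set z | forall x, dY (B x) y = dX x z].

(* The Moore-Penrose inverse is the linear extension of the inverse of
   B : N(B)^perp -> R(B) to R(B) + R(B)^perp which vanishes on R(B)^perp: the
   value at g is the unique x in N(B)^perp such that g - B x is in R(B)^perp.
   Outside R(B) + R(B)^perp the value 0 is conventional. *)
Definition pseudo_inverse (B : X -> Y) (g : Y) : X :=
  xget 0 [set x | ortho_compl dX (null_space B) x /\ ortho_compl dY (range B) (g - B x)].

End Operators.

(* Sequences start at 0: [sigma k], [v k], [u k] are the (k+1)-st terms. *)
Record singular_system (R : realType) (X Y : completeNormedModType R[i])
    (dX : {dot X for conjC}) (dY : {dot Y for conjC}) (A : X -> Y)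
    (sigma : nat -> R) (v : nat -> X) (u : nat -> Y) : Prop := {
  ss_noninc : forall k, sigma k.+1 <= sigma k;
  ss_pos : forall k, 0 < sigma k;
  ss_right : orthonormal_basis dX (ortho_compl dX (null_space A)) v;
  ss_left : orthonormal_basis dY (ortho_compl dY (null_space (adjoint dX dY A))) u;
  ss_A : forall k, A (v k) = (sigma k)%:C *: u k;
  ss_adj : forall k, adjoint dX dY A (u k) = (sigma k)%:C *: v k }.

Definition filter_function (R : realType) (sigma : nat -> R) (F : R -> R)
    : Prop :=
  let vals := [set F (sigma k ^+ 2) | k in [set: nat]] in
  [/\ forall k, 0 < F (sigma k ^+ 2), 0 < inf vals & has_ubound vals].

Section Reconstruction.
Variables (R : realType) (X Y : completeNormedModType R[i]).
Variables (dX : {dot X for conjC}) (dY : {dot Y for conjC}).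
Variables (sigma : nat -> R) (v : nat -> X) (u : nat -> Y).
Variables (F : R -> R).

Definition regularized (h : Y) : X :=
  limn (series (fun k =>
    ((F (sigma k ^+ 2) * sigma k)%:C * dY h (u k)) *: v k)).

Definition filter_mx (N : nat) : 'M[R[i]]_N :=
  diag_mx (\row_(k < N) (F (sigma k ^+ 2))%:C).

Definition sigma_mx (N : nat) : 'M[R[i]]_N :=
  diag_mx (\row_(k < N) (sigma k)%:C).

Variable phi : nat -> X.

Definition normal_equation (N M : nat) (g : Y) (b : 'cV[R[i]]_M) : Prop :=
  analysis dX phi M (synthesis v
    (invmx (filter_mx N *m filter_mx N) *m
       analysis dX v N (synthesis phi b))) =
  analysis dX phi M (synthesis v
    (invmx (filter_mx N) *m sigma_mx N *m analysis dY u N g)).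

(* The coefficient vector need not be unique, since the first M frame elements
   may be linearly dependent. *)
Definition is_reconstruction (N M : nat) (g : Y) (r : X) : Prop :=
  exists b : 'cV[R[i]]_M, normal_equation N g b /\ r = synthesis phi b.

Definition filtered_proj (N : nat) (h : X) : X :=
  \sum_(k < N) (((F (sigma k ^+ 2)) ^- 2)%:C * dX h (v k)) *: v k.

Definition reconstruction_angle (N M : nat) : R :=
  subspace_angle dX (first_span phi M)
    (filtered_proj N @` first_span phi M).

End Reconstruction.

(* Main.v *)
Require Import Defs.
From mathcomp Require Import all_boot all_order all_algebra.
From mathcomp Require Import complex.
From mathcomp Require Import all_classical all_reals all_analysis.
From mathcomp Require Import ring lra.

Set Implicit Arguments.
Unset Strict Implicit.
Unset Printing Implicit Defensive.

Import Order.TTheory GRing.Theory Num.Theory Num.Def.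
Import numFieldNormedType.Exports.

Local Open Scope classical_set_scope.
Local Open Scope complex_scope.
Local Open Scope ring_scope.

(** Write [x] for the regularized solution, so that
    [<x, v_k> = F (sigma_k ^ 2) sigma_k <A f, u_k>], let [T] be the span of the
    first [M] frame elements, let [L] be the diagonal operator with
    coefficients [F (sigma_k ^ 2) ^ -2], [k < N], and let [S = L (T)].  Comparing
    coefficients, the right-hand side of the normal equation is that of
    [L x], and [L] is self-adjoint; the reconstructions are therefore exactly
    the [r] in [T] such that [x - r] is orthogonal to [S]
    ([is_reconstructionP]): [r] is the oblique projection of [x] onto [T]
    along the orthogonal complement of [S].

    Existence.  Since [L = G ^ 2] for the self-adjoint diagonal operator [G]
    with coefficients [F (sigma_k ^ 2) ^ -1], the condition on [r] says that
    [G r] is the orthogonal projection of [G x] onto [G (T)], a least squares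
    problem, which always has a solution ([oblique_proj_exists]).

    Bounds.  Let [c] be the cosine of the angle, so that
    [c |w| <= |P_S w|] on [T].  This gives uniqueness at once, and
    [c |r| <= |P_S r| = |P_S x| <= |x|].  For the error put [h = x - P_T x] and
    [w = r - P_T x]: then [|x - r|^2 = |h|^2 + |w|^2], and as [x - r] is
    orthogonal to [S],
    [|w|^2 = |<x - r, w - P_S w>| <= |x - r| sqrt (1 - c^2) |w|], which yields
    [c |x - r| <= |h|] ([oblique_proj_error]).  The bound on the distance
    to the generalized solution follows by the triangle inequality.

    Sharpness.  The range of the regularization contains all finite
    combinations of the [v_k], hence [S] ([regularized_surj]).  A unit vector
    [w] of [T] is the reconstruction from [x = P_S w], so a constant [C] in the
    first bound satisfies [1 <= C |P_S w|] for all such [w], that is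
    [1 <= C c].  The same data serve for the second bound
    ([oblique_error_sharp]) except when [w] lies in [S], where both sides
    vanish; there [1 <= C] suffices, which holds because some [v_k] lies
    outside the finite-dimensional space [T] ([orthonormal_not_in_span]). *)

(** * The real-valued norm *)

Section RealNorm.
Variables (R : realType) (V : normedZmodType R[i]).
Implicit Types x y : V.

Lemma nrmE x : (nrm x)%:C = `|x|.
Proof. by rewrite RRe_real // ger0_real. Qed.

Lemma nrm_ge0 x : 0 <= nrm x.
Proof. by rewrite -ler0c nrmE. Qed.

Lemma nrm_eq0 x : (nrm x == 0) = (x == 0).
Proof. by rewrite -(inj_eq (@complexI R)) nrmE normr_eq0. Qed.

Lemma nrm_triangle x y : nrm (x + y) <= nrm x + nrm y.
Proof. by rewrite -lecR rmorphD /= !nrmE ler_normD. Qed.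

Lemma nrm_distC x y : nrm (x - y) = nrm (y - x).
Proof. by rewrite /nrm distrC. Qed.

End RealNorm.

Lemma nrmM_real (R : realType) (a : R) (z : R[i]) :
  0 <= a -> nrm (a%:C * z) = a * nrm z.
Proof.
move=> a0; apply: (@complexI R); rewrite nrmE normrM rmorphM /= nrmE.
by rewrite ger0_norm // ler0c.
Qed.

(** * Orthogonality and projections onto spans of finitely many vectors *)

Section InnerProduct.
Variables (R : realType) (X : completeNormedModType R[i]).
Variables (d : {dot X for conjC}) (normP : induces_norm d).
Implicit Types (x y z : X) (e : nat -> X).

Lemma dotC x y : d x y = conjC (d y x).
Proof. by have := hermC d x y; rewrite expr0 mul1r. Qed.

Lemma dot_eq0C x y : d x y = 0 -> d y x = 0.
Proof. by rewrite dotC => /eqP; rewrite conjC_eq0 => /eqP. Qed.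

Lemma sqr_nrm x : d x x = (nrm x ^+ 2)%:C.
Proof. by rewrite normP rmorphXn /= nrmE. Qed.

Lemma nrm_dotxx x : nrm (d x x : R[i]) = nrm x ^+ 2.
Proof. by rewrite sqr_nrm /nrm ger0_norm // ler0c sqr_ge0. Qed.

Lemma pythagoras x y :
  d x y = 0 -> nrm (x + y) ^+ 2 = nrm x ^+ 2 + nrm y ^+ 2.
Proof.
move=> xy0; apply: (@complexI R); rewrite rmorphD /= -!sqr_nrm.
exact: hnormDd.
Qed.

Lemma pythagoras_sub x y :
  d x y = 0 -> nrm (x - y) ^+ 2 = nrm x ^+ 2 + nrm y ^+ 2.
Proof.
move=> xy0; apply: (@complexI R); rewrite rmorphD /= -!sqr_nrm.
exact: hnormBd.
Qed.

Lemma pythagoras_le x y : d x y = 0 -> nrm x <= nrm (x + y).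
Proof.
move=> /pythagoras xy.
by rewrite -ler_sqr ?nnegrE ?nrm_ge0// xy lerDl sqr_ge0.
Qed.

(** The orthogonal projection of [x] onto the line through [y] is not longer
    than [x]. *)
Lemma cauchy_schwarz x y : `|d x y| <= `|x| * `|y|.
Proof.
have [->|y0] := eqVneq y 0; first by rewrite linear0r normr0 normr0 mulr0.
pose a := d x y / d y y.
have dy0 : d y y != 0 by rewrite dnorm_eq0.
have ort : d (x - a *: y) (a *: y) = 0.
  by rewrite linearZr_LR /= linearBl /= linearZl_LR /= divfK // subrr mulr0.
have /pythagoras_le : d (a *: y) (x - a *: y) = 0 by exact: dot_eq0C.
rewrite addrC subrK -lecR !nrmE normrZ normrM normfV.
rewrite normP [X in _ / X]ger0_norm ?exprn_ge0//.
have ny : `|y| != 0 by rewrite normr_eq0.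
have -> : `|d x y| / `|y| ^+ 2 * `|y| = `|d x y| / `|y| by field.
by rewrite ler_pdivrMr // normr_gt0.
Qed.

Lemma first_spanP e n x :
  first_span e n x <-> exists b : 'cV[R[i]]_n, x = synthesis e b.
Proof. by split=> -[b]; [move=> _ <-; exists b|move=> ->; exists b]. Qed.

Lemma synthesisD e n (b c : 'cV[R[i]]_n) :
  synthesis e (b + c) = synthesis e b + synthesis e c.
Proof.
by rewrite /synthesis -big_split; apply: eq_bigr => j _; rewrite mxE scalerDl.
Qed.

Lemma synthesisZ e n a (b : 'cV[R[i]]_n) :
  synthesis e (a *: b) = a *: synthesis e b.
Proof.
by rewrite /synthesis scaler_sumr; apply: eq_bigr => j _; rewrite mxE scalerA.
Qed.

Lemma first_spanD e n x y :
  first_span e n x -> first_span e n y -> first_span e n (x + y).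
Proof. by move=> [b _ <-] [c _ <-]; exists (b + c); rewrite ?synthesisD. Qed.

Lemma first_spanZ e n a x : first_span e n x -> first_span e n (a *: x).
Proof. by move=> [b _ <-]; exists (a *: b); rewrite ?synthesisZ. Qed.

Lemma first_spanN e n x : first_span e n x -> first_span e n (- x).
Proof. by rewrite -scaleN1r; exact: first_spanZ. Qed.

Lemma first_spanB e n x y :
  first_span e n x -> first_span e n y -> first_span e n (x - y).
Proof. by move=> ex /first_spanN; exact: first_spanD. Qed.

Lemma first_span_mem e n k : (k < n)%N -> first_span e n (e k).
Proof.
move=> kn; exists (\col_(j < n) (Ordinal kn == j)%:R) => //.
rewrite /synthesis (bigD1 (Ordinal kn)) //= mxE eqxx scale1r big1 ?addr0//.
by move=> j /negPf jk; rewrite mxE eq_sym jk scale0r.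
Qed.

Lemma first_spanS e n x : first_span e n x -> first_span e n.+1 x.
Proof.
move=> [b _ <-]; rewrite /synthesis.
elim/big_ind: _ => [|y z|j _].
- by rewrite -(scale0r (e 0%N)); apply/first_spanZ/first_span_mem.
- exact: first_spanD.
- exact/first_spanZ/first_span_mem/ltnW/ltn_ord.
Qed.

Lemma ortho_compl_first_span e n x :
  (forall j, (j < n)%N -> d x (e j) = 0) -> ortho_compl d (first_span e n) x.
Proof.
move=> xe w [b _ <-]; rewrite /synthesis linear_sumr /= big1 // => j _.
by rewrite linearZr_LR /= xe ?mulr0.
Qed.

(** One Gram-Schmidt step: if [q] is the projection of [e n] onto the span of
    the preceding vectors, the projection onto the enlarged span adds the
    component along [z = e n - q].  When [z = 0] the coefficient is divided by
    zero, harmlessly, since it multiplies [z]. *)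
Lemma first_span_proj_exists e n x :
  exists2 p, first_span e n p & ortho_compl d (first_span e n) (x - p).
Proof.
elim: n x => [|n IH] x.
  exists 0; first by exists 0 => //; rewrite /synthesis big_ord0.
  exact: ortho_compl_first_span.
have [p Sp px] := IH x; have [q Sq qe] := IH (e n).
pose z := e n - q; pose a := d (x - p) z / d z z.
exists (p + a *: z).
  apply: first_spanD; first exact: first_spanS.
  by apply/first_spanZ/first_spanB; [exact: first_span_mem|exact: first_spanS].
have zz : d (x - (p + a *: z)) z = 0.
  rewrite opprD addrA linearBl /= linearZl_LR /= /a.
  have [->|z0] := eqVneq z 0; first by rewrite !linear0r ?mul0r ?subr0.
  by rewrite divfK ?dnorm_eq0 // subrr.
have low w : first_span e n w -> d (x - (p + a *: z)) w = 0.
  move=> Sw; rewrite opprD addrA linearBl /= linearZl_LR /= px // qe //.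
  by rewrite mulr0 subrr.
apply: ortho_compl_first_span => j; rewrite ltnS leq_eqVlt => /predU1P[->|jn].
  by rewrite -[e n](subrK q) linearDr /= zz low // addr0.
by apply/low/first_span_mem.
Qed.

Lemma ortho_projP e n x (S := first_span e n) :
  S (ortho_proj d S x) /\ ortho_compl d S (x - ortho_proj d S x).
Proof.
have [p Sp px] := first_span_proj_exists e n x.
by rewrite /ortho_proj; case: xgetP => [y _ //|/(_ p)[]].
Qed.

Lemma ortho_proj_unique e n x p (S := first_span e n) :
  S p -> ortho_compl d S (x - p) -> ortho_proj d S x = p.
Proof.
move=> Sp xp; have [Sq xq] := ortho_projP e n x.
set q := ortho_proj _ _ _ in Sq xq *.
have Spq : S (q - p) by exact: first_spanB.
apply/eqP; rewrite -subr_eq0 -(dnorm_eq0 d); apply/eqP.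
rewrite [X in d X _](_ : _ = (x - p) - (x - q)).
  by rewrite linearBl /= xp // xq // subrr.
by rewrite opprB [RHS]addrC addrA subrK.
Qed.

Lemma ortho_projZ e n a x (S := first_span e n) :
  ortho_proj d S (a *: x) = a *: ortho_proj d S x.
Proof.
have [Sq xq] := ortho_projP e n x.
apply: ortho_proj_unique; first exact: first_spanZ.
by move=> w Sw; rewrite -scalerBr linearZl_LR /= xq // mulr0.
Qed.

Lemma ortho_proj_closest e n x w (S := first_span e n) :
  S w -> nrm (x - ortho_proj d S x) <= nrm (x - w).
Proof.
move=> Sw; have [Sp xp] := ortho_projP e n x.
rewrite [x - w](_ : _ = (x - ortho_proj d S x) + (ortho_proj d S x - w)).
  by apply/pythagoras_le/xp/first_spanB.
by rewrite addrA subrK.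
Qed.

Lemma ortho_proj_nrm e n x :
  nrm x ^+ 2 = nrm (ortho_proj d (first_span e n) x) ^+ 2 +
               nrm (x - ortho_proj d (first_span e n) x) ^+ 2.
Proof.
have [Sp xp] := ortho_projP e n x.
by rewrite -pythagoras ?subrKC//; apply/dot_eq0C/xp.
Qed.

Lemma ortho_proj_le e n x : nrm (ortho_proj d (first_span e n) x) <= nrm x.
Proof.
by rewrite -ler_sqr ?nnegrE ?nrm_ge0// (ortho_proj_nrm e n x) lerDl sqr_ge0.
Qed.

End InnerProduct.

(** * Oblique projections *)

(** Two finite-dimensional subspaces [T] and [S], with [c] a positive lower
    bound of the cosine of the angle from [T] to [S]. *)
Section ObliqueProjection.
Variables (R : realType) (X : completeNormedModType R[i]).
Variables (d : {dot X for conjC}) (normP : induces_norm d).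
Variables (e1 e2 : nat -> X) (m n : nat) (c : R).
Local Notation T := (first_span e1 m).
Local Notation S := (first_span e2 n).
Local Notation PT := (ortho_proj d T).
Local Notation PS := (ortho_proj d S).
Hypothesis c_gt0 : 0 < c.
Hypothesis cos_le : forall w, T w -> c * nrm w <= nrm (PS w).
Implicit Types (x r w : X).

(** The vector [r] is the projection of [x] onto [T] along the orthogonal
    complement of [S]. *)
Definition oblique_proj_of x r := T r /\ ortho_compl d S (x - r).

(** The difference of two such projections lies in [T] and is orthogonal to
    [S], so its projection onto [S] vanishes. *)
Lemma oblique_proj_unique x r r' :
  oblique_proj_of x r -> oblique_proj_of x r' -> r = r'.
Proof.
move=> [Tr xr] [Tr' xr'].
have Trr' : T (r - r') by exact: first_spanB.
have PS0 : PS (r - r') = 0.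
  apply: ortho_proj_unique => //.
    by rewrite -(scale0r (PS x)); apply/first_spanZ/(ortho_projP d e2 n x).1.
  move=> w Sw; rewrite subr0.
  rewrite (_ : r - r' = (x - r') - (x - r)).
    by rewrite linearBl /= xr // xr' // subrr.
  by rewrite opprB [RHS]addrC addrA subrK.
have := cos_le Trr'; rewrite PS0 /nrm normr0 /= => le0.
apply/eqP; rewrite -subr_eq0 -nrm_eq0 eq_le nrm_ge0 andbT.
by rewrite -(pmulr_rle0 _ c_gt0).
Qed.

(** The vectors [x] and [r] have the same projection onto [S]. *)
Lemma oblique_proj_nrm x r : oblique_proj_of x r -> c * nrm r <= nrm x.
Proof.
move=> [Tr xr]; apply: (le_trans (cos_le Tr)).
have [Sp rp] := ortho_projP d e2 n r.
have -> : PS r = PS x.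
  apply/esym/ortho_proj_unique => // w Sw.
  by rewrite -(subrKA r) linearDl /= xr // rp // addr0.
exact: ortho_proj_le.
Qed.

(** This bounds the norm of the complementary projection by the same constant
    [1 / c] as the projection itself: [w], the oblique projection of
    [x - PT x], makes an angle with [x - r] whose cosine is at most the sine
    of the angle between [w] and [S]. *)
Lemma oblique_proj_error x r :
  c <= 1 -> oblique_proj_of x r -> c * nrm (x - r) <= nrm (x - PT x).
Proof.
move=> c_le1 [Tr xr].
have [Tp xp] := ortho_projP d e1 m x.
set p := PT x in Tp xp *; pose w := r - p.
have Tw : T w by exact: first_spanB.
have [Sq wq] := ortho_projP d e2 n w.
have xrE : x - r = (x - p) - w by rewrite /w opprB addrA subrK.
have := pythagoras_sub normP (xp _ Tw); rewrite -xrE => E2.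
have W2 := ortho_proj_nrm normP e2 n w.
(* [x - PT x] is orthogonal to [w], and [x - r] to [PS w] *)
have CS : nrm w ^+ 2 <= nrm (x - r) * nrm (w - PS w).
  have -> : nrm w ^+ 2 = nrm (d (x - r) (w - PS w) : R[i]).
    rewrite linearBr /= (xr _ Sq) subr0 xrE linearBl /= (xp _ Tw) sub0r.
    by rewrite -(nrm_dotxx normP) /nrm normrN.
  by rewrite -lecR rmorphM /= !nrmE; exact: cauchy_schwarz.
have := cos_le Tw.
move: (nrm_ge0 w) (nrm_ge0 (x - r)) (nrm_ge0 (w - PS w)).
move: (nrm_ge0 (PS w)) (nrm_ge0 (x - p)).
move: (nrm w) (nrm (x - r)) (nrm (w - PS w)) (nrm (PS w)) (nrm (x - p)) E2 W2 CS.
move=> W E Q P H E2 W2 CS P0 H0 W0 E0 Q0 cWP.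
have c2 : c ^+ 2 * W ^+ 2 <= P ^+ 2.
  by rewrite -exprMn ler_sqr ?nnegrE // mulr_ge0 // ltW.
suff HE : c ^+ 2 * E ^+ 2 <= H ^+ 2.
  by rewrite -ler_sqr ?nnegrE ?mulr_ge0 ?(ltW c_gt0) // exprMn.
have [W00|Wn0] := eqVneq W 0.
  rewrite W00 expr0n addr0 in E2; rewrite E2 ler_piMl ?sqr_ge0 //.
  by rewrite exprn_ile1 // ltW.
have Wp : 0 < W ^+ 2 by rewrite exprn_gt0 // lt_neqAle eq_sym Wn0.
have Q2 : Q ^+ 2 <= (1 - c ^+ 2) * W ^+ 2 by lra.
have W4 : W ^+ 2 * W ^+ 2 <= E ^+ 2 * Q ^+ 2.
  by rewrite -!expr2 -exprMn ler_sqr ?nnegrE ?sqr_ge0 ?mulr_ge0.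
have : W ^+ 2 * W ^+ 2 <= ((1 - c ^+ 2) * E ^+ 2) * W ^+ 2.
  apply: (le_trans W4); apply: le_trans (ler_wpM2l (sqr_ge0 E) Q2) _.
  by rewrite mulrCA mulrA.
by rewrite ler_pM2r //; lra.
Qed.

Lemma ortho_proj_oblique w : T w -> oblique_proj_of (PS w) w.
Proof.
move=> Tw; split => // s Ss; have [_ wq] := ortho_projP d e2 n w.
by rewrite -opprB linearNl /= wq // oppr0.
Qed.

(** With [x = PS w] and [a = |x|], the error [x - w] has norm
    [sqrt (1 - a^2)], whereas [|PT x| >= <x, w> = a^2] shows that
    [|x - PT x| <= a sqrt (1 - a^2)].  The ratio of the two is at least [1 / a]
    unless [a = 1]; then both sides vanish and [1 <= C] is needed. *)
Lemma oblique_error_sharp w C : T w -> nrm w = 1 -> 1 <= C ->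
  nrm (PS w - w) <= C * nrm (PS w - PT (PS w)) -> 1 <= C * nrm (PS w).
Proof.
move=> Tw w1 C1.
have [Sq wq] := ortho_projP d e2 n w; set q := PS w in Sq wq *.
have [Tp qp] := ortho_projP d e1 m q; set p := PT q in Tp qp *.
have w2 := ortho_proj_nrm normP e2 n w; rewrite -/q w1 nrm_distC in w2.
have q2 := ortho_proj_nrm normP e1 m q; rewrite -/p in q2.
have pq : nrm q ^+ 2 <= nrm p.
  have -> : nrm q ^+ 2 = nrm (d p w : R[i]).
    have -> : d p w = d q q.
      have -> : d p w = d q w.
        by apply/esym/eqP; rewrite -subr_eq0 -linearBl /= qp.
      rewrite -[X in d q X](subrK q w) linearDr /= (dot_eq0C (wq _ Sq)).
      by rewrite add0r.
    by rewrite nrm_dotxx.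
  rewrite -(mulr1 (nrm p)) -w1 -lecR rmorphM /= !nrmE; exact: cauchy_schwarz.
move: (nrm_ge0 q) (nrm_ge0 p) (nrm_ge0 (q - w)) (nrm_ge0 (q - p)).
move: (nrm q) (nrm p) (nrm (q - w)) (nrm (q - p)) w2 q2 pq.
move=> a P E H w2 q2 pq a0 P0 E0 H0 EH.
have C0 : 0 <= C by lra.
have [E00|En0] := eqVneq E 0.
  have -> : a = 1; last by rewrite mulr1.
  by apply/eqP; rewrite -sqrp_eq1 //; apply/eqP; rewrite E00 in w2; lra.
have Ep : 0 < E ^+ 2 by rewrite exprn_gt0 // lt_neqAle eq_sym En0.
have P2 : a ^+ 2 * a ^+ 2 <= P ^+ 2.
  by rewrite -!expr2 ler_sqr ?nnegrE ?sqr_ge0.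
have H2 : H ^+ 2 <= a ^+ 2 * E ^+ 2.
  have -> : E ^+ 2 = 1 - a ^+ 2 by lra.
  by rewrite mulrBr mulr1; lra.
have : E ^+ 2 <= (C * H) ^+ 2 by rewrite ler_sqr ?nnegrE ?mulr_ge0.
rewrite exprMn => EC.
have : 1 * E ^+ 2 <= (C * a) ^+ 2 * E ^+ 2.
  rewrite mul1r exprMn -mulrA; apply: le_trans EC _.
  by rewrite ler_wpM2l ?sqr_ge0.
rewrite ler_pM2r // => le1.
by rewrite -ler_sqr ?nnegrE ?mulr_ge0 // expr1n.
Qed.

End ObliqueProjection.

(** * The cosine of the subspace angle *)

(** Projections do not increase norms, so the infimum lies in the domain of
    the arc cosine. *)
Lemma cos_subspace_angleE (R : realType) (X : completeNormedModType R[i])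
    (d : {dot X for conjC}) (normP : induces_norm d) (W : set X)
    (e : nat -> X) (n : nat) (S := first_span e n) :
  cos (subspace_angle d W S) =
  inf [set nrm (ortho_proj d S w) | w in [set w | W w /\ nrm w = 1]].
Proof.
apply: acosK; rewrite in_itv /=.
set E := image _ _.
have lbE : lbound E 0 by move=> _ [w _ <-]; exact: nrm_ge0.
have [[x Ex]|E0] := pselect (E !=set0).
  have := Ex => -[w [_ w1] wx].
  have := ge_inf (ex_intro _ 0 lbE) Ex.
  have := lb_le_inf (ex_intro _ x Ex) lbE.
  have : x <= 1 by rewrite -wx -w1; exact: ortho_proj_le.
  lra.
rewrite (_ : E = set0) ?inf0 ?lerN10 ?ler01 //.
by apply/seteqP; split => // x Ex; apply: E0; exists x.
Qed.

Section CosAngle.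
Variables (R : realType) (X : completeNormedModType R[i]).
Variables (d : {dot X for conjC}) (normP : induces_norm d).
Variables (e1 e2 : nat -> X) (m n : nat).
Local Notation T := (first_span e1 m).
Local Notation S := (first_span e2 n).
Local Notation cosTS := (cos (subspace_angle d T S)).

(** The infimum of the empty set is zero, so a positive cosine excludes the
    degenerate case of a zero space. *)
Lemma cos_angle_exists_unit : 0 < cosTS -> exists2 w, T w & nrm w = 1.
Proof.
rewrite cos_subspace_angleE // => inf_gt0.
apply: contrapT => noT; move: inf_gt0; rewrite (_ : image _ _ = set0) ?inf0 ?ltxx//.
by apply/seteqP; split => // x [w [Tw w1] _]; apply: noT; exists w.
Qed.

(** The infimum is taken over unit vectors; the case of arbitrary vectors is
    obtained by scaling. *)
Lemma cos_angle_le w : T w -> cosTS * nrm w <= nrm (ortho_proj d S w).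
Proof.
move=> Tw; rewrite cos_subspace_angleE //; set E := image _ _.
have [->|w0] := eqVneq w 0.
  by rewrite /nrm normr0 mulr0; exact: nrm_ge0.
have nw0 : 0 < nrm w by rewrite lt_neqAle eq_sym nrm_eq0 w0 nrm_ge0.
pose u := ((nrm w)^-1)%:C *: w.
have nZ (z : X) : nrm (((nrm w)^-1)%:C *: z) = nrm z / nrm w.
  apply: (@complexI R); rewrite nrmE normrZ rmorphM /= nrmE mulrC.
  by rewrite ger0_norm // ler0c invr_ge0 ltW.
have Eu : E (nrm (ortho_proj d S u)).
  exists u => //; split; first exact: first_spanZ.
  by rewrite nZ divff // gt_eqF.
have lbE : lbound E 0 by move=> _ [z _ <-]; exact: nrm_ge0.
have := ge_inf (ex_intro _ 0 lbE) Eu.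
by rewrite ortho_projZ nZ ler_pdivlMr.
Qed.

Lemma cos_angle_ge k : 0 < cosTS ->
  (forall w, T w -> nrm w = 1 -> k <= nrm (ortho_proj d S w)) -> k <= cosTS.
Proof.
move=> /cos_angle_exists_unit[w Tw w1] kP; rewrite cos_subspace_angleE //.
apply: lb_le_inf; first by exists (nrm (ortho_proj d S w)), w.
by move=> _ [z [Tz z1] <-]; exact: kP.
Qed.

End CosAngle.

(** * Operators that are diagonal in an orthonormal system *)

Section DiagonalOperator.
Variables (R : realType) (X : completeNormedModType R[i]).
Variables (d : {dot X for conjC}) (v : nat -> X).
Hypothesis v_orthonormal : forall i j, d (v i) (v j) = (i == j)%:R.

Lemma dot_orthonormal_sum n (c : 'I_n -> R[i]) (k : 'I_n) :
  d (\sum_(j < n) c j *: v j) (v k) = c k.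
Proof.
rewrite linear_sumlz (bigD1 k) //= linearZl_LR /= v_orthonormal eqxx mulr1.
rewrite big1 ?addr0 // => j jk; rewrite linearZl_LR /= v_orthonormal.
by rewrite (_ : (_ == _) = false) ?mulr0 //; exact/negbTE.
Qed.

Lemma dot_orthonormal_sum_out n (c : 'I_n -> R[i]) k :
  (n <= k)%N -> d (\sum_(j < n) c j *: v j) (v k) = 0.
Proof.
move=> nk; rewrite linear_sumlz big1 // => j _; rewrite linearZl_LR /=.
by rewrite v_orthonormal (ltn_eqF (leq_trans (ltn_ord j) nk)) mulr0.
Qed.

Lemma orthonormal_expansion n x :
  first_span v n x -> \sum_(k < n) d x (v k) *: v k = x.
Proof.
move=> [b _ <-]; apply: eq_bigr => k _; congr (_ *: _).
exact: dot_orthonormal_sum.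
Qed.

Definition diag_op (N : nat) (a : nat -> R) (h : X) : X :=
  \sum_(k < N) ((a k)%:C * d h (v k)) *: v k.

Lemma diag_opB N a x y :
  diag_op N a (x - y) = diag_op N a x - diag_op N a y.
Proof.
rewrite /diag_op -sumrB; apply: eq_bigr => k _.
by rewrite linearBl mulrBr scalerBl.
Qed.

Lemma diag_op_synthesis N a (e : nat -> X) M (b : 'cV[R[i]]_M) :
  diag_op N a (synthesis e b) = synthesis (diag_op N a \o e) b.
Proof.
rewrite /diag_op /synthesis /= [RHS](eq_bigr (fun j : 'I_M =>
    \sum_(k < N) ((a k)%:C * (b j ord0 * d (e j) (v k))) *: v k)); last first.
  move=> j _; rewrite scaler_sumr; apply: eq_bigr => k _.
  by rewrite scalerA mulrCA.
rewrite exchange_big; apply: eq_bigr => k _ /=.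
rewrite linear_sumlz mulr_sumr scaler_suml; apply: eq_bigr => j _.
by rewrite linearZl_LR.
Qed.

Lemma diag_op_image N a (e : nat -> X) M :
  diag_op N a @` first_span e M = first_span (diag_op N a \o e) M.
Proof.
apply/seteqP; split => [_ [_ [b _ <-] <-]|_ [b _ <-]].
  by exists b => //; rewrite diag_op_synthesis.
by exists (synthesis e b); [exists b|rewrite diag_op_synthesis].
Qed.

Lemma dot_diag_op N a x y :
  d (diag_op N a x) y = \sum_(k < N) (a k)%:C * (d x (v k) * conjC (d y (v k))).
Proof.
rewrite /diag_op linear_sumlz; apply: eq_bigr => k _.
by rewrite linearZl_LR /= -mulrA (dotC d (v k) y).
Qed.

Lemma conjC_real (a : R) : conjC a%:C = a%:C :> R[i].
Proof. by apply/CrealP; rewrite complex_real. Qed.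

Lemma diag_op_selfadjoint N a x y : d (diag_op N a x) y = d x (diag_op N a y).
Proof.
rewrite (dotC d x) !dot_diag_op rmorph_sum /=; apply: eq_bigr => k _.
by rewrite !rmorphM /= conjCK conjC_real [conjC _ * _]mulrC.
Qed.

Lemma diag_op_coef N a x (k : 'I_N) :
  d (diag_op N a x) (v k) = (a k)%:C * d x (v k).
Proof. exact: (dot_orthonormal_sum (fun j : 'I_N => (a j)%:C * d x (v j))). Qed.

Lemma diag_op_sqr N a x y :
  d (diag_op N a x) (diag_op N a y) = d (diag_op N (fun k => a k ^+ 2) x) y.
Proof.
rewrite !dot_diag_op; apply: eq_bigr => k _.
rewrite diag_op_coef rmorphM /= conjC_real rmorphXn /=.
by ring.
Qed.

Lemma diag_op_span N a x : first_span v N (diag_op N a x).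
Proof.
exists (\col_k ((a k)%:C * d x (v k))) => //.
by apply: eq_bigr => k _; rewrite mxE.
Qed.

Lemma synthesis_diag_mx N (D : 'rV[R[i]]_N) (a : nat -> R) x :
  (forall k, D 0 k = (a k)%:C) ->
  synthesis v (diag_mx D *m analysis d v N x) = diag_op N a x.
Proof.
move=> Da; apply: eq_bigr => k _; congr (_ *: _).
by rewrite mul_diag_mx !mxE Da.
Qed.

End DiagonalOperator.

Lemma invmx_diag (K : fieldType) n (D : 'rV[K]_n) :
  (forall k, D 0 k != 0) -> invmx (diag_mx D) = diag_mx (\row_k (D 0 k)^-1).
Proof.
move=> D0; set E := diag_mx (\row_k _).
have DE : diag_mx D *m E = 1%:M.
  rewrite mulmx_diag -diag_const_mx; congr diag_mx.
  by apply/rowP => k; rewrite !mxE divff.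
have [uD _] := mulmx1_unit DE.
by rewrite -[LHS]mulmx1 -DE mulmxA mulVmx // mul1mx.
Qed.

(** * The normal equation *)

Section NormalEquation.
Variables (R : realType) (X Y : completeNormedModType R[i]).
Variables (dX : {dot X for conjC}) (dY : {dot Y for conjC}).
Variables (sigma : nat -> R) (v : nat -> X) (u : nat -> Y) (F : R -> R).
Hypothesis v_orthonormal : forall i j, dX (v i) (v j) = (i == j)%:R.
Hypothesis F_gt0 : forall k, 0 < F (sigma k ^+ 2).
Variables (phi : nat -> X) (N M : nat).
Local Notation L := (filtered_proj dX sigma v F N).

Lemma filtered_projE : L = diag_op dX v N (fun k => (F (sigma k ^+ 2)) ^- 2).
Proof. by []. Qed.

(** Both sides of the normal equation are of the form [analysis phi (L y)]:
    with [y] the candidate on the left, and with [y = x] on the right, as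
    [F^-1 sigma <g, u_k> = F^-2 <x, v_k>]. *)
Lemma normal_equationP g x (b : 'cV[R[i]]_M) :
  (forall k, dX x (v k) = (F (sigma k ^+ 2) * sigma k)%:C * dY g (u k)) ->
  normal_equation dX dY sigma v u F phi N g b <->
  forall j : 'I_M, dX (x - synthesis phi b) (L (phi j)) = 0.
Proof.
move=> xv; rewrite /normal_equation.
have F0 k : F (sigma k ^+ 2) != 0 by rewrite gt_eqF.
have FC0 k : (F (sigma k ^+ 2))%:C != 0 by rewrite fmorph_eq0.
have -> : synthesis v (invmx (filter_mx sigma F N *m filter_mx sigma F N) *m
    analysis dX v N (synthesis phi b)) = L (synthesis phi b).
  rewrite mulmx_diag invmx_diag; last by move=> k; rewrite !mxE mulf_neq0.
  rewrite filtered_projE; apply: synthesis_diag_mx => k.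
  by rewrite !mxE fmorphV rmorphXn /= expr2.
have -> : synthesis v (invmx (filter_mx sigma F N) *m sigma_mx sigma N *m
    analysis dY u N g) = L x.
  rewrite invmx_diag; last by move=> k; rewrite !mxE.
  rewrite mulmx_diag /L; apply: eq_bigr => k _; congr (_ *: _).
  rewrite mul_diag_mx !mxE xv fmorphV rmorphXn /= rmorphM /=.
  by have := FC0 k; set f := _%:C => f0; field.
have eqj j : (dX (x - synthesis phi b) (L (phi j)) = 0) <->
    (dX (L (synthesis phi b)) (phi j) = dX (L x) (phi j)).
  rewrite filtered_projE -diag_op_selfadjoint diag_opB linearBl /=.
  by split => [/eqP|->]; [rewrite subr_eq0 => /eqP|rewrite subrr].
split=> [/colP eqn j|eqn].
  by apply/eqj; have := eqn j; rewrite !mxE.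
by apply/colP => j; rewrite !mxE; apply/eqj/eqn.
Qed.

Lemma is_reconstructionP g x r :
  (forall k, dX x (v k) = (F (sigma k ^+ 2) * sigma k)%:C * dY g (u k)) ->
  is_reconstruction dX dY sigma v u F phi N M g r <->
  oblique_proj_of dX phi (L \o phi) M M x r.
Proof.
move=> xv; split=> [[b [/(normal_equationP b xv) eqn ->]]|[[b _ <-] ort]].
  split; first by exists b.
  by apply: ortho_compl_first_span => j jM; exact: (eqn (Ordinal jM)).
exists b; split; last by [].
apply/(normal_equationP b xv) => j.
exact/ort/(@first_span_mem _ _ (L \o phi)).
Qed.

(** With [G] the positive square root of [L], orthogonality of [x - r] to
    [L phi_j] means orthogonality of [G x - G r] to [G phi_j]; so [r] is
    obtained from the orthogonal projection of [G x] onto [G (T)]. *)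
Lemma oblique_proj_exists x :
  exists r, oblique_proj_of dX phi (L \o phi) M M x r.
Proof.
pose G := diag_op dX v N (fun k => (F (sigma k ^+ 2))^-1).
have [_ [b _ <-] ort] := first_span_proj_exists dX (G \o phi) M (G x).
exists (synthesis phi b); split; first by exists b.
apply: ortho_compl_first_span => j jM /=.
rewrite filtered_projE -diag_op_selfadjoint.
rewrite (_ : (fun k => _) = (fun k => (F (sigma k ^+ 2))^-1 ^+ 2)); last first.
  by apply/funext => k; rewrite exprVn.
rewrite -diag_op_sqr // diag_opB diag_op_synthesis.
exact/ort/(@first_span_mem _ _ (G \o phi)).
Qed.

End NormalEquation.

(** * Series in an orthonormal system *)

Section OrthonormalSeries.
Variables (R : realType) (X : completeNormedModType R[i]).
Variables (d : {dot X for conjC}) (normP : induces_norm d) (v : nat -> X).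
Hypothesis v_orthonormal : forall i j, d (v i) (v j) = (i == j)%:R.

Lemma bessel x n : \sum_(k < n) nrm (d x (v k) : R[i]) ^+ 2 <= nrm x ^+ 2.
Proof.
pose p := diag_op d v n (fun=> 1) x.
have pp y : d p y = d p (diag_op d v n (fun=> 1) y).
  rewrite diag_op_sqr //; congr (d (diag_op _ _ _ _ _) _).
  by apply/funext => k; rewrite expr1n.
have xp : d p (x - p) = 0 by rewrite linearBr /= pp subrr.
suff -> : \sum_(k < n) nrm (d x (v k) : R[i]) ^+ 2 = nrm p ^+ 2.
  rewrite ler_sqr ?nnegrE ?nrm_ge0 // -[X in _ <= nrm X](subrKC p).
  exact: pythagoras_le.
apply: (@complexI R); rewrite -(sqr_nrm normP) -pp dot_diag_op rmorph_sum.
by apply: eq_bigr => k _; rewrite rmorphXn /= nrmE mul1r normCK.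
Qed.

Lemma sqr_nrm_orthonormal_sum (c : nat -> R[i]) m n :
  nrm (\sum_(m <= k < n) c k *: v k) ^+ 2 = \sum_(m <= k < n) nrm (c k) ^+ 2.
Proof.
apply: (@complexI R); rewrite -(sqr_nrm normP) rmorph_sum /= linear_sumlz.
apply: eq_big_nat => k /andP[mk kn]; rewrite linearZl_LR linear_sumr /=.
rewrite (bigD1_seq k) ?mem_index_iota ?mk ?iota_uniq //= big1 => [|j /negPf jk].
  by rewrite linearZr_LR /= v_orthonormal eqxx mulr1 addr0 rmorphXn /= nrmE normCK.
by rewrite linearZr_LR /= v_orthonormal eq_sym jk mulr0.
Qed.

(** The partial sums are Cauchy because the squared norm of a block is the
    corresponding block of a convergent real series. *)
Lemma orthonormal_series_cvg (c : nat -> R[i]) B :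
  (forall n, \sum_(k < n) nrm (c k) ^+ 2 <= B) ->
  cvgn (series (fun k => c k *: v k)).
Proof.
move=> cB; apply/cauchy_cvgP/cauchy_seriesP => e e0.
have [r re r0] : exists2 r : R, e = r%:C & 0 < r.
  have eE : e = (complex.Re e)%:C by rewrite RRe_real // gtr0_real.
  by exists (complex.Re e) => //; rewrite -ltcR -eE.
have : cvgn (series (fun k => nrm (c k) ^+ 2)).
  apply: nondecreasing_is_cvgn.
    by apply: nondecreasing_series => k _ _; exact: sqr_ge0.
  by exists B => _ [n _ <-]; rewrite /series /= big_mkord.
move=> /cauchy_cvgP/cauchy_seriesP/(_ (r ^+ 2)).
rewrite exprn_gt0 // => /(_ isT); apply: filterS => -[m n] /= lt_r.
rewrite re -nrmE ltcR -ltr_sqr ?nnegrE ?nrm_ge0 ?(ltW r0) //.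
rewrite sqr_nrm_orthonormal_sum; apply: le_lt_trans lt_r.
exact: ler_norm.
Qed.

(** From index [k.+1] on, the partial sums have coefficient [c k]; by
    Cauchy-Schwarz the coefficient of the limit is arbitrarily close to it. *)
Lemma orthonormal_series_coef (c : nat -> R[i]) k :
  cvgn (series (fun k => c k *: v k)) ->
  d (limn (series (fun k => c k *: v k))) (v k) = c k.
Proof.
set s := series _ => cvg_s; set x := limn s.
have vk : `|v k| = 1.
  apply/eqP; rewrite -(@pexpr_eq1 _ _ 2) // -normP v_orthonormal eqxx //.
apply/eqP; rewrite -subr_eq0 -normr_eq0; apply/negPn/negP => ne0.
have e0 : 0 < `|d x (v k) - c k| by rewrite lt_neqAle eq_sym ne0 normr_ge0.
move/cvgrPdist_lt: cvg_s => /(_ _ e0) [n _ near_s].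
have := near_s (maxn n k.+1) (leq_maxl _ _); rewrite /= => lt_e.
have sk : d (s (maxn n k.+1)) (v k) = c k.
  rewrite /s /series /= big_mkord.
  exact: (dot_orthonormal_sum v_orthonormal (fun j => c j)
    (Ordinal (leq_maxr n k.+1))).
have := cauchy_schwarz normP (x - s (maxn n k.+1)) (v k).
rewrite linearBl /= sk vk mulr1 => le_e.
by have := le_lt_trans le_e lt_e; rewrite ltxx.
Qed.

Lemma finite_series_lim (c : nat -> R[i]) n :
  (forall k, (n <= k)%N -> c k = 0) ->
  limn (series (fun k => c k *: v k)) = \sum_(k < n) c k *: v k.
Proof.
move=> c0; apply: (@lim_near_cst X (@norm_hausdorff _ X)); exists n => // m /= nm.
rewrite /series /= -(big_mkord xpredT (fun k => c k *: v k)).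
rewrite (big_cat_nat (leq0n n) nm) /= [X in _ + X = _]big_nat_cond.
rewrite [X in _ + X = _]big1 ?addr0 // => k.
by rewrite andbT => /andP[/c0 -> _]; rewrite scale0r.
Qed.

(** A matrix with [M.+1] rows and [M] columns has a nonzero left kernel, so
    [M.+1] vectors in the span of [M] vectors are linearly dependent. *)
Lemma orthonormal_not_in_span (e : nat -> X) M :
  exists2 k, (k <= M)%N & ~ first_span e M (v k).
Proof.
apply: contrapT => noN.
have /choice[b bE] (k : 'I_M.+1) : exists b : 'cV_M, v k = synthesis e b.
  apply/(first_spanP e M (v k)); apply: contrapT => vk; apply: noN.
  by exists k; rewrite // -ltnS ltn_ord.
pose B := \matrix_(k < M.+1, j < M) b k j 0.
have : kermx B != 0.
  rewrite kermx_eq0 /row_free; apply/negP => /eqP rB.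
  by have := rank_leq_col B; rewrite rB ltnn.
case/rowV0Pn => z /sub_kermxP zB /eqP; apply.
have sum0 : \sum_(k < M.+1) z 0 k *: v k = 0.
  rewrite (eq_bigr (fun k : 'I_M.+1 =>
      \sum_(j < M) (z 0 k * B k j) *: e j)); last first.
    move=> k _; rewrite bE scaler_sumr; apply: eq_bigr => j _.
    by rewrite scalerA mxE.
  rewrite exchange_big big1 // => j _ /=; rewrite -scaler_suml.
  by move/rowP/(_ j): zB; rewrite !mxE => ->; rewrite scale0r.
apply/rowP => k; rewrite mxE.
by rewrite -(dot_orthonormal_sum v_orthonormal (z 0) k) sum0 linear0l.
Qed.

End OrthonormalSeries.

(** * The regularization operator *)

Section Regularization.
Variables (R : realType) (X Y : completeNormedModType R[i]).
Variables (dX : {dot X for conjC}) (dY : {dot Y for conjC}).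
Hypotheses (normX : induces_norm dX) (normY : induces_norm dY).
Variables (A : {linear X -> Y}) (sigma : nat -> R) (v : nat -> X) (u : nat -> Y).
Hypothesis A_svd : singular_system dX dY A sigma v u.
Variables (F : R -> R) (F_filter : filter_function sigma F).

Let v_orthonormal i j : dX (v i) (v j) = (i == j)%:R.
Proof. by have [+ _] := ss_right A_svd. Qed.

Let u_orthonormal i j : dY (u i) (u j) = (i == j)%:R.
Proof. by have [+ _] := ss_left A_svd. Qed.

(** The series converges because the factors [F (sigma_k ^ 2) sigma_k] are
    bounded and, by Bessel's inequality, the coefficients of [h] are square
    summable. *)
Lemma regularized_coef h k :
  dX (regularized dY sigma v u F h) (v k) =
  (F (sigma k ^+ 2) * sigma k)%:C * dY h (u k).
Proof.
have [F0 _ [B B_ub]] := F_filter.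
have sigma_le j : sigma j <= sigma 0%N.
  by elim: j => // j; exact/le_trans/(ss_noninc A_svd).
have FB j : F (sigma j ^+ 2) <= B by apply: B_ub; exists j.
apply: (orthonormal_series_coef normX v_orthonormal
  (c := fun k => (F (sigma k ^+ 2) * sigma k)%:C * dY h (u k))).
apply: (orthonormal_series_cvg normX v_orthonormal
  (B := (B * sigma 0%N) ^+ 2 * nrm h ^+ 2)) => n.
apply: le_trans (ler_wpM2l (sqr_ge0 _) (bessel normY u_orthonormal h n)).
rewrite mulr_sumr; apply: ler_sum => j _.
have s0 := ss_pos A_svd j.
have Fs0 : 0 <= F (sigma j ^+ 2) * sigma j by rewrite mulr_ge0 ?ltW.
have FsB : F (sigma j ^+ 2) * sigma j <= B * sigma 0%N.
  by rewrite ler_pM ?(ltW (F0 j)) ?(ltW s0).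
rewrite nrmM_real // exprMn ler_wpM2r ?sqr_ge0 //.
by rewrite ler_sqr ?nnegrE // (le_trans Fs0).
Qed.

(** On a finite combination of the [v_k] the regularization of [A] multiplies
    the coefficients by [F (sigma_k ^ 2) sigma_k ^ 2], which is inverted
    coefficientwise. *)
Lemma regularized_surj n x :
  first_span v n x -> exists f, regularized dY sigma v u F (A f) = x.
Proof.
move=> vx; have [F0 _ _] := F_filter.
exists (diag_op dX v n (fun k => (F (sigma k ^+ 2) * sigma k ^+ 2)^-1) x).
have AE : A (diag_op dX v n (fun k => (F (sigma k ^+ 2) * sigma k ^+ 2)^-1) x) =
    \sum_(k < n) ((F (sigma k ^+ 2) * sigma k)^-1%:C * dX x (v k)) *: u k.
  rewrite linear_sum; apply: eq_bigr => k _.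
  rewrite linearZ /= (ss_A A_svd) scalerA mulrAC -rmorphM /=.
  congr ((_ %:C * _) *: _).
  by have := F0 k; have := ss_pos A_svd k => s0 f0; field; rewrite !gt_eqF.
rewrite /regularized (_ : (fun k => _) =
    fun k => (if (k < n)%N then dX x (v k) else 0) *: v k); last first.
  apply/funext => k; congr (_ *: _); rewrite AE.
  case: ltnP => kn.
    rewrite (dot_orthonormal_sum u_orthonormal (fun k : 'I_n =>
      (F (sigma k ^+ 2) * sigma k)^-1%:C * dX x (v k)) (Ordinal kn)) /=.
    rewrite mulrA -rmorphM /= divff ?mul1r // mulf_neq0 ?gt_eqF //.
    exact: ss_pos A_svd k.
  by rewrite (dot_orthonormal_sum_out u_orthonormal) ?mulr0.
rewrite (@finite_series_lim _ _ v _ n); last first.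
  by move=> k; rewrite leqNgt => /negPf ->.
rewrite -[RHS](orthonormal_expansion v_orthonormal vx).
by apply: eq_bigr => k _; rewrite ltn_ord.
Qed.

End Regularization.

(** * Existence, stability and sharpness *)

Theorem mainTheorem1 (R : realType) (X Y : completeNormedModType R[i])
    (dX : {dot X for conjC}) (dY : {dot Y for conjC})
    (hilbertX : induces_norm dX) (hilbertY : induces_norm dY)
    (sepX : separable_space X) (sepY : separable_space Y)
    (A : {linear X -> Y}) (A_bounded : continuous A)
    (A_compact : compact_operator A)
    (sigma : nat -> R) (v : nat -> X) (u : nat -> Y)
    (A_svd : singular_system dX dY A sigma v u)
    (phi : nat -> X) (phi_frame : frame dX (ortho_compl dX (null_space A)) phi)
    (F : R -> R) (F_filter : filter_function sigma F)
    (N M : nat) (N_gt0 : (0 < N)%N) (M_gt0 : (0 < M)%N) :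
  let TM := first_span phi M in
  let theta := reconstruction_angle dX sigma v F phi N M in
  let sec := (cos theta)^-1 in
  let f_alpha := fun f => regularized dY sigma v u F (A f) in
  let is_f_NM := fun f => is_reconstruction dX dY sigma v u F phi N M (A f) in
  0 < cos theta ->
  [/\ forall f : X, exists! r : X, is_f_NM f r,
      forall f r : X, is_f_NM f r ->
        let f_dag := pseudo_inverse dX dY A (A f) in
        [/\ nrm r <= sec * nrm (f_alpha f),
            nrm (f_alpha f - r) <=
              sec * nrm (f_alpha f - ortho_proj dX TM (f_alpha f)) &
            nrm (f_dag - r) <=
              (1 + 2 * sec) * nrm (f_dag - f_alpha f) +
              sec * nrm (f_dag - ortho_proj dX TM f_dag)],
      forall c : R,
        (forall f r : X, is_f_NM f r -> nrm r <= c * nrm (f_alpha f)) ->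
        sec <= c &
      forall c : R,
        (forall f r : X, is_f_NM f r ->
          nrm (f_alpha f - r) <=
            c * nrm (f_alpha f - ortho_proj dX TM (f_alpha f))) ->
        sec <= c].
Proof.
move=> TM theta sec f_alpha is_f_NM.
have vO i j : dX (v i) (v j) = (i == j)%:R by have [+ _] := ss_right A_svd.
have F0 k : 0 < F (sigma k ^+ 2) by have [+ _ _] := F_filter.
pose L := filtered_proj dX sigma v F N.
pose S := first_span (L \o phi) M.
rewrite /sec; have -> : theta = subspace_angle dX TM S.
  congr subspace_angle.
  exact: (diag_op_image dX v N (fun k => (F (sigma k ^+ 2)) ^- 2) phi M).
set co := cos _ => co_gt0.
have co_le w : TM w -> co * nrm w <= nrm (ortho_proj dX S w).
  exact: (cos_angle_le hilbertX).
have co_le1 : co <= 1 by exact: cos_le1.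
have recP f r : is_f_NM f r <-> oblique_proj_of dX phi (L \o phi) M M (f_alpha f) r.
  by apply: is_reconstructionP => // k;
    exact: (regularized_coef hilbertX hilbertY A_svd F_filter).
have sec_le C : (forall w, TM w -> nrm w = 1 -> 1 <= C * nrm (ortho_proj dX S w)) ->
    co^-1 <= C.
  move=> C1; have [w Tw w1] := cos_angle_exists_unit hilbertX co_gt0.
  have C0 : 0 < C.
    have := lt_le_trans ltr01 (C1 w Tw w1).
    by rewrite pmulr_lgt0 // lt_neqAle nrm_ge0 andbT; apply/eqP => p0;
      have := C1 w Tw w1; rewrite -p0 mulr0 ler10.
  rewrite invf_ple // ; apply: cos_angle_ge => // z Tz z1.
  by rewrite -[C^-1]mulr1 ler_pdivrMl //; exact: C1.
(* S is contained in the range of L, hence in the span of v_0, ..., v_(N-1) *)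
have S_range w : exists f, f_alpha f = ortho_proj dX S w.
  have [[b _ <-] _] := ortho_projP dX (L \o phi) M w.
  apply: (regularized_surj A_svd F_filter (n := N)).
  rewrite -(diag_op_synthesis dX v N (fun k => (F (sigma k ^+ 2)) ^- 2)).
  exact: diag_op_span.
split.
- move=> f; have [r xr] := oblique_proj_exists sigma F vO phi N M (f_alpha f).
  exists r; split; first exact/recP.
  by move=> r' /recP; exact: (oblique_proj_unique co_gt0 co_le).
- move=> f r /recP xr; set f_dag := pseudo_inverse _ _ _ _.
  have err : nrm (f_alpha f - r) <=
      co^-1 * nrm (f_alpha f - ortho_proj dX TM (f_alpha f)).
    by rewrite ler_pdivlMl //; exact: (oblique_proj_error hilbertX co_gt0 co_le).
  split=> //.
    by rewrite ler_pdivlMl //; exact: (oblique_proj_nrm hilbertX co_le).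
  have := ortho_proj_closest hilbertX (f_alpha f) (ortho_projP dX phi M f_dag).1.
  have := nrm_triangle (f_dag - f_alpha f) (f_alpha f - r).
  have := nrm_triangle (f_alpha f - f_dag) (f_dag - ortho_proj dX TM f_dag).
  rewrite !subrKA (nrm_distC (f_alpha f) f_dag) -/TM => tri1 tri2 best.
  have s0 : 0 <= co^-1 by rewrite invr_ge0 ltW.
  have := mulr_ge0 s0 (nrm_ge0 (f_dag - f_alpha f)).
  have := ler_wpM2l s0 (le_trans best tri1).
  by rewrite mulrDr => *; lra.
- move=> C CP; apply: sec_le => w Tw w1.
  have [f fE] := S_range w; rewrite -fE -w1; apply/CP/recP.
  by rewrite fE; exact: ortho_proj_oblique.
- move=> C CP.
  (* the error at v_k outside T is at least its distance to T *)
  have C1 : 1 <= C.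
    have [k kM vk] := orthonormal_not_in_span vO phi M.
    have [f fE] := regularized_surj A_svd F_filter (first_span_mem v (ltnSn k)).
    have [r xr] := oblique_proj_exists sigma F vO phi N M (v k).
    have [Tp _] := ortho_projP dX phi M (v k).
    have h0 : 0 < nrm (v k - ortho_proj dX TM (v k)).
      rewrite lt_neqAle nrm_ge0 andbT eq_sym nrm_eq0 subr_eq0.
      by apply/eqP => vkE; apply: vk; rewrite vkE.
    have : is_f_NM f r by apply/recP; rewrite /f_alpha fE.
    move=> /CP; rewrite /f_alpha fE => le_C.
    have := le_trans (ortho_proj_closest hilbertX (v k) xr.1) le_C.
    by rewrite -[X in X <= _]mul1r ler_pM2r.
  apply: sec_le => w Tw w1.
  have [f fE] := S_range w.
  apply: (@oblique_error_sharp _ _ _ hilbertX phi (L \o phi) M M w C Tw w1 C1).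
  by rewrite -fE; apply/CP/recP; rewrite fE; exact: ortho_proj_oblique.
Qed.
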